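(* For every $n\in\mathbb{N}$ the graph $G(3,5,n)$ has a Hamiltonian path, and for every even $n>2$ the graph $G(3,5,n)$ is Hamiltonian (has a Hamiltonian cycle).
   Context: For a prime $p$ and $n\in\mathbb{N}$, $G(p,n)$ is the simple graph with vertex set $\{2,4,\ldots,2n\}$ in which two distinct vertices $a,b$ are adjacent if and only if both $\frac{a+b}{2}$ and $\frac{|a-b|}{2}$ are odd positive integers neither of which equals $pk$ for an integer $k\ge 2$. $G(3,5,n)$ is the intersection of $G(3,n)$ and $G(5,n)$: the graph on $\{2,4,\ldots,2n\}$ whose edge set is the intersection of their edge sets. *)

(* Defs.v *)
From mathcomp Require Import all_boot all_order ssralg ssrnum ssrint.
Set Implicit Arguments. Unset Strict Implicit. Unset Printing Implicit Defensive.

Record simple_graph (V : finType) := SimpleGraph {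
  adj :> rel V;
  adj_sym : symmetric adj;
  adj_irr : irreflexive adj
}.

Lemma inter_sym (V : finType) (G H : simple_graph V) :
  symmetric [rel a b | G a b && H a b].
Proof. by move=> a b; rewrite /= (adj_sym G) (adj_sym H). Qed.

Lemma inter_irr (V : finType) (G H : simple_graph V) :
  irreflexive [rel a b | G a b && H a b].
Proof. by move=> a; rewrite /= (adj_irr G). Qed.

Definition graph_inter (V : finType) (G H : simple_graph V) : simple_graph V :=
  SimpleGraph (@inter_sym V G H) (@inter_irr V G H).

(* A path is given by the sequence of its vertices; a one-vertex sequence is a
   path, and the empty sequence only matters for the graph without vertices. *)
Definition has_hamiltonian_path (V : finType) (G : simple_graph V) : Prop :=
  exists s : seq V, [/\ sorted G s, uniq s & forall v, v \in s].

(* [ucycle] alone accepts a single edge, traversed back and forth, as a cycle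
   of length 2; cycles of a simple graph have at least 3 vertices. *)
Definition hamiltonian (V : finType) (G : simple_graph V) : Prop :=
  exists s : seq V, [/\ ucycle G s, 2 < size s & forall v, v \in s].

(* The finite type {2, 4, ..., 2n}. *)
Definition vertex (n : nat) : finType := seq_sub [seq 2 * i | i <- iota 1 n].

(* m = p k for some k >= 2; the bound k <= m makes the quantifier finite and
   loses nothing when p > 0, see [proper_multipleP]. *)
Definition proper_multiple (p m : nat) : bool :=
  [exists k : 'I_m.+1, (2 <= k) && (m == p * k)].

Lemma proper_multipleP (p m : nat) : prime p ->
  reflect (exists2 k, 2 <= k & m = p * k) (proper_multiple p m).
Proof.
move=> /prime_gt0 p_gt0; apply: (iffP existsP) => [[k /andP[k2 /eqP ->]]|[k k2 E]].
  by exists k.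
have km : k < m.+1 by rewrite ltnS E leq_pmull.
by exists (Ordinal km); rewrite /= k2 -E eqxx.
Qed.

Definition admissible (p m : nat) : bool :=
  [&& odd m, 0 < m & ~~ proper_multiple p m].

(* On even labels the halvings are exact; the subtraction inside `|_| is the
   signed one of int. *)
Definition G_rel (p n : nat) : rel (vertex n) := fun a b =>
  [&& a != b, admissible p (val a + val b)./2
    & admissible p `|val a - val b|./2].

Lemma G_rel_sym (p n : nat) : symmetric (@G_rel p n).
Proof. by move=> a b; rewrite /G_rel eq_sym addnC distnC. Qed.

Lemma G_rel_irr (p n : nat) : irreflexive (@G_rel p n).
Proof. by move=> a; rewrite /G_rel eqxx. Qed.

Definition G (p n : nat) : simple_graph (vertex n) :=
  SimpleGraph (@G_rel_sym p n) (@G_rel_irr p n).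

Definition G35 (n : nat) : simple_graph (vertex n) :=
  graph_inter (G 3 n) (G 5 n).

(* Main.v *)
Require Import Defs.
From mathcomp Require Import all_boot.
From mathcomp Require Import ssrint zify.

(** Halving the labels, vertices become 1, ..., n and x, y are adjacent when
    x + y and |x - y| are odd and each is 3, 5 or coprime to 15.  Apart from
    the edges with x + y <= 5, adjacency survives the translation of both ends
    by 30.  So if a Hamiltonian path of {1, ..., n} runs from a to b, and the
    next block {n+1, ..., n+30} splits into a path from a+30 to a neighbour of
    a and a path from a neighbour of b to b+30, then the concatenation is a
    Hamiltonian path of {1, ..., n+30} from a+30 to b+30, and the same split,
    translated, applies again; the closing edge ba is translated along.  It
    remains to exhibit the splits for n = 5, ..., 34, which cover all residues
    mod 30, and to treat n <= 4 directly. *)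

(** * Adjacency of halved labels and its translation by 30 *)

Definition good (m : nat) : bool :=
  odd m && ((m \in [:: 3; 5]) || coprime m 15).

(** Subtraction on [nat] is truncated, so [(x - y) + (y - x)] is the absolute difference. *)
Definition link : rel nat :=
  [rel x y | good (x + y) && good ((x - y) + (y - x))].

(* The links that stay links under translation by 30. *)
Definition slink : rel nat := [rel x y | (5 < x + y) && link x y].

Lemma slink_link (x y : nat) : slink x y -> link x y.
Proof. by case/andP. Qed.

(** Translating both ends by 30 adds 60 = 4 * 15 to their sum, which preserves parity and
    coprimality to 15. The bound rules out the exceptional values 3 and 5: 63 and 65 are not
    [good]. *)
Lemma good_add60 (m : nat) : 5 < m -> good m -> good (m + 60).
Proof.
move=> m_gt5 /andP[odd_m]; rewrite !inE.
have /negbTE-> : m != 3 by lia.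
have /negbTE-> : m != 5 by lia.
move=> /= cop; rewrite /good oddD odd_m /=; apply/orP; right.
by rewrite /coprime -gcdnC -(gcdnMDl 4 15 m) gcdnC addnC in cop *.
Qed.

Lemma slink_add30 (x y : nat) : slink x y -> slink (x + 30) (y + 30).
Proof.
case/andP=> gt5 /andP[sum_ok dif_ok].
have E : x + 30 + (y + 30) = x + y + 60 by rewrite addnACA.
by rewrite /slink /link /= !subnDr dif_ok andbT E ltn_addr // good_add60.
Qed.

Lemma slink_shift (k x y : nat) :
  slink x y -> slink (x + 30 * k) (y + 30 * k).
Proof.
elim: k => [|k IHk]; first by rewrite muln0 !addn0.
by move=> /IHk/slink_add30; rewrite -!(addnA _ (30 * k)) -mulnSr.
Qed.

Lemma path_slink_shift (k x : nat) (s : seq nat) : path slink x s ->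
  path slink (x + 30 * k) (map (addn^~ (30 * k)) s).
Proof.
elim: s x => //= y s IHs x /andP[xy ys].
by rewrite slink_shift //= IHs.
Qed.

(** * Extension of a tour by blocks of 30 *)

(** Links join numbers of opposite parity, so the ends of the path can be adjacent only for even
    [n]. *)
Definition tour (n x : nat) (s : seq nat) : bool :=
  [&& path link x s, perm_eq (x :: s) (iota 1 n)
    & ~~ odd n ==> slink (last x s) x].

(* A path start :: rest of {1, ..., n} and the two halves of a split of the
   next block; the first half is start + 30 :: front. *)
Record seed := Seed {
  start : nat; rest : seq nat; front : seq nat; back : seq nat
}.

(** The initial path stays in place, so [link] is enough for it; the split and its junctions with
    [a] and [b] get translated, hence [slink]. *)
Definition seed_ok (n : nat) (c : seed) : bool :=
  let a := start c in let b := last a (rest c) in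
  [&& tour n a (rest c),
      path slink (a + 30) (rcons (front c) a),
      path slink b (back c),
      last b (back c) == b + 30
    & perm_eq (a + 30 :: front c ++ back c) (iota n.+1 30)].

Lemma seed_tour (n k : nat) (c : seed) : seed_ok n c ->
  exists s, tour (n + 30 * k) (start c + 30 * k) s.
Proof.
case: c => a t p q /and5P[/= tour0 pathp pathq /eqP lastq permpq].
set b := last a t in pathq lastq.
(* The induction must track the last vertex too, since the second half of the next block is attached
   there. *)
suff [s [? _]] : exists s, tour (n + 30 * k) (a + 30 * k) s /\
                           last (a + 30 * k) s = b + 30 * k by exists s.
elim: k => [|k [s [/and3P[paths perms clos] lasts]]].
  by exists t; rewrite muln0 !addn0.
pose f := addn^~ (30 * k).
exists (map f p ++ (a + 30 * k) :: s ++ map f q).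
have Ea : a + 30 * k.+1 = a + 30 + 30 * k by rewrite mulnS addnA.
have Eb : b + 30 * k.+1 = b + 30 + 30 * k by rewrite mulnS addnA.
have lastE : last (a + 30 * k.+1)
    (map f p ++ (a + 30 * k) :: s ++ map f q) = b + 30 * k.+1.
  by rewrite last_cat /= last_cat lasts (last_map f) lastq Eb.
split=> //; apply/and3P; split.
(* The last edge of [pathp] gives the junction of the first half with the old start. *)
- have := path_slink_shift k _ _ pathp.
  rewrite map_rcons -cats1 !cat_path /= andbT -/f -Ea => /andP[pathp' linkp].
  rewrite (slink_link _ _ linkp) (sub_path slink_link pathp') cat_path.
  rewrite paths lasts /=.
  by apply: (sub_path slink_link); apply: path_slink_shift.
- have -> : iota 1 (n + 30 * k.+1) =
            iota 1 (n + 30 * k) ++ map f (iota n.+1 30).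
    have -> : n + 30 * k.+1 = n + 30 * k + 30 by rewrite mulnSr addnA.
    rewrite iotaD add1n -addSn (addnC n.+1) iotaDl.
    by congr (_ ++ _); apply: eq_map => i; rewrite /f addnC.
  have := perm_map f permpq; rewrite /= map_cat => permpq'.
  (* It remains to move the first half of the block in front of the old path. *)
  apply: perm_trans (perm_cat perms permpq').
  rewrite Ea.
  exact: permEl (perm_catCA (_ :: map f p) (_ :: s) (map f q)).
- rewrite lastE; apply/implyP => even_n.
  have {}even_n : ~~ odd n by rewrite oddD oddM addbF in even_n.
  apply: slink_shift; case/and3P: tour0 => _ _ /implyP; exact.
Qed.

(* The i-th entry, found by computer search, is for n = i + 5. *)
Definition seeds : seq seed := [::
  Seed 1 [:: 4; 3; 2; 5] [:: 28; 25; 22; 19; 12; 7; 10; 9; 14; 33; 34; 27;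
    26; 15; 16; 21; 32; 29; 30] [:: 8; 11; 18; 13; 24; 23; 20; 17; 6; 35];
  Seed 1 [:: 4; 3; 2; 5; 6] [:: 28; 25; 22; 19; 24; 29; 32; 9; 8; 15; 34;
    27; 14; 33; 16; 21; 26; 23; 20; 17; 12; 35; 18] [:: 11; 30; 13; 10; 7;
    36];
  Seed 3 [:: 4; 7; 6; 5; 2; 1] [:: 34; 37; 36; 35; 32; 29; 24; 23; 26; 15;
    16; 13; 10; 27; 14] [:: 18; 19; 30; 11; 8; 21; 22; 25; 28; 9; 20; 17;
    12; 31];
  Seed 2 [:: 1; 6; 7; 4; 3; 8; 5] [:: 29; 12; 11; 30; 37; 34; 27; 10; 13;
    16; 33; 26; 23; 20; 17; 14; 9; 38; 15] [:: 24; 19; 22; 21; 28; 25; 36;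
    31; 18; 35];
  Seed 3 [:: 8; 9; 2; 1; 4; 7; 6; 5] [:: 14; 17; 20; 23; 26] [:: 36; 37; 34;
    27; 10; 13; 16; 21; 38; 15; 28; 39; 32; 29; 24; 25; 22; 19; 30; 11; 18;
    31; 12; 35];
  Seed 2 [:: 5; 6; 1; 4; 7; 10; 3; 8; 9] [:: 29; 12; 11; 18; 31; 30; 19; 22;
    25; 36; 35; 24; 13; 16; 27; 14; 17; 20; 23; 26; 15] [:: 28; 21; 38; 33;
    34; 37; 40; 39];
  Seed 9 [:: 10; 7; 4; 1; 6; 11; 8; 3; 2; 5] [:: 34; 37; 40; 33; 14; 27; 26;
    23; 20; 17; 30; 29; 32; 21; 16; 15; 22] [:: 24; 13; 36; 31; 28; 25; 12;
    19; 18; 41; 38; 35];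
  Seed 3 [:: 8; 11; 12; 5; 2; 1; 6; 7; 4; 9; 10] [:: 14; 17; 20; 23; 26] [::
    27; 16; 13; 24; 19; 22; 25; 18; 29; 30; 41; 42; 31; 36; 35; 38; 21; 28;
    15; 32; 39; 34; 37; 40];
  Seed 11 [:: 12; 5; 8; 3; 2; 1; 4; 7; 6; 13; 10; 9] [:: 38; 35; 42] [:: 14;
    17; 36; 43; 30; 31; 18; 19; 24; 29; 32; 15; 16; 27; 34; 37; 40; 33; 26;
    23; 20; 21; 28; 25; 22; 39];
  Seed 10 [:: 13; 6; 11; 12; 7; 4; 1; 2; 5; 8; 9; 14; 3] [:: 43; 24; 17; 20;
    23; 36; 37; 30; 31; 42; 41; 38; 35; 32; 29; 18; 19; 22; 25; 28; 21; 16;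
    15; 26; 27] [:: 44; 39; 34; 33];
  Seed 13 [:: 10; 7; 12; 11; 6; 1; 4; 15; 14; 9; 2; 3; 8; 5] [:: 40; 37; 34;
    27; 44; 39; 32; 29; 42; 19; 22; 45; 26; 21; 16; 33; 28; 31; 30; 17; 20;
    23; 24; 25; 18] [:: 36; 41; 38; 35];
  Seed 8 [:: 11; 12; 5; 6; 13; 16; 3; 10; 7; 4; 1; 2; 9; 14; 15] [:: 41; 42;
    35; 18; 31; 36; 17; 20; 23; 30; 19; 24; 29; 32; 21] [:: 26; 27; 46; 43;
    40; 37; 34; 33; 44; 39; 28; 25; 22; 45];
  Seed 5 [:: 8; 11; 12; 17; 6; 13; 16; 15; 14; 3; 10; 7; 4; 1; 2; 9] [:: 32;
    29; 18; 19; 24] [:: 38; 41; 42; 47; 30; 31; 36; 25; 22; 21; 28; 45; 44;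
    33; 26; 23; 20; 27; 46; 43; 40; 37; 34; 39];
  Seed 3 [:: 16; 13; 10; 7; 4; 9; 14; 17; 6; 1; 12; 11; 18; 5; 2; 15; 8] [::
    46; 43; 40] [:: 21; 26; 23; 20; 27; 44; 47; 30; 37; 34; 45; 32; 29; 24;
    19; 22; 39; 28; 25; 42; 31; 36; 35; 48; 41; 38];
  Seed 15 [:: 16; 13; 10; 7; 4; 3; 14; 9; 8; 11; 6; 17; 12; 19; 18; 5; 2; 1]
    [:: 46; 43; 40; 37; 34; 33; 44; 47; 24; 29; 32; 27; 26; 23; 20; 21; 22;
    39; 28] [:: 30; 49; 42; 25; 36; 35; 38; 41; 48; 31];
  Seed 6 [:: 13; 16; 15; 14; 17; 20; 9; 10; 7; 4; 3; 8; 11; 18; 19; 12; 1;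
    2; 5] [:: 31; 28; 25; 22; 21; 50; 47; 44; 39; 34; 33; 46; 27; 40; 37]
    [:: 42; 49; 48; 43; 30; 41; 38; 45; 26; 23; 24; 29; 32; 35];
  Seed 9 [:: 14; 17; 20; 21; 16; 15; 8; 3; 10; 13; 6; 11; 18; 19; 12; 7; 4;
    1; 2; 5] [:: 44; 47; 50; 33; 34; 27; 26; 23; 24; 29; 32; 45; 46; 43; 40;
    37; 30; 49; 48; 31; 28; 51; 22] [:: 42; 25; 36; 41; 38; 35];
  Seed 1 [:: 18; 19; 22; 21; 20; 17; 12; 11; 8; 5; 2; 9; 14; 15; 4; 7; 10;
    3; 16; 13; 6] [:: 28; 25; 48] [:: 23; 26; 27; 46; 43; 24; 29; 30; 49;
    52; 51; 50; 47; 42; 41; 38; 35; 32; 45; 44; 39; 40; 33; 34; 37; 36];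
  Seed 9 [:: 22; 19; 18; 23; 20; 17; 14; 15; 16; 13; 10; 21; 2; 3; 8; 5; 12;
    11; 6; 7; 4; 1] [:: 44; 47; 50; 53; 24; 29; 32; 35; 38; 41; 36; 25; 42;
    49; 52; 51; 28] [:: 48; 43; 40; 27; 26; 45; 46; 33; 34; 37; 30; 31];
  Seed 23 [:: 20; 17; 14; 9; 22; 19; 24; 7; 12; 11; 6; 5; 8; 15; 4; 1; 2; 3;
    16; 21; 10; 13; 18] [:: 50; 47; 44; 27; 26] [:: 29; 32; 39; 34; 45; 52;
    49; 30; 31; 28; 51; 46; 33; 38; 41; 42; 25; 36; 35; 54; 37; 40; 43; 48];
  Seed 17 [:: 14; 15; 16; 13; 10; 7; 4; 3; 20; 21; 2; 1; 6; 23; 24; 5; 8;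
    11; 18; 19; 12; 25; 22; 9] [:: 44; 27; 26; 45; 46; 33; 34; 37; 40; 43;
    54] [:: 28; 31; 36; 55; 52; 49; 30; 53; 50; 51; 32; 29; 48; 35; 42; 41;
    38; 39];
  Seed 4 [:: 7; 10; 13; 16; 21; 26; 23; 20; 3; 14; 15; 22; 19; 24; 17; 6;
    25; 12; 11; 8; 5; 18; 1; 2; 9] [:: 37; 40; 43; 46; 27] [:: 28; 33; 44;
    45; 56; 51; 32; 29; 30; 31; 36; 47; 50; 53; 54; 35; 38; 41; 48; 55; 42;
    49; 52; 39];
  Seed 23 [:: 26; 21; 16; 13; 10; 27; 20; 3; 14; 17; 24; 7; 4; 9; 8; 11; 6;
    25; 22; 19; 12; 1; 18; 5; 2; 15] [:: 50; 47; 44; 57; 56; 33; 46; 51; 40;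
    43; 54] [:: 34; 37; 36; 55; 52; 49; 30; 29; 48; 41; 42; 31; 28; 39; 38;
    35; 32; 45];
  Seed 12 [:: 11; 8; 5; 18; 19; 22; 25; 28; 21; 16; 13; 24; 17; 6; 1; 2; 15;
    26; 23; 20; 9; 14; 3; 4; 27; 10; 7] [:: 31] [:: 54; 49; 52; 55; 58; 51;
    32; 29; 48; 35; 38; 41; 36; 53; 30; 43; 46; 45; 56; 33; 34; 39; 50; 47;
    44; 57; 40; 37];
  Seed 1 [:: 4; 7; 10; 13; 16; 27; 26; 3; 14; 15; 2; 21; 28; 9; 22; 19; 18;
    29; 24; 25; 12; 11; 8; 5; 6; 23; 20; 17] [:: 48] [:: 30; 59; 42; 41; 38;
    35; 32; 39; 58; 55; 52; 49; 54; 43; 36; 37; 34; 45; 46; 51; 40; 57; 56;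
    53; 50; 33; 44; 47];
  Seed 18 [:: 29; 12; 11; 8; 5; 2; 1; 30; 19; 24; 23; 26; 21; 28; 25; 6; 7;
    4; 15; 22; 9; 10; 27; 14; 17; 20; 3; 16; 13] [:: 59] [:: 54; 49; 52; 55;
    58; 51; 32; 35; 42; 31; 36; 41; 38; 45; 56; 53; 60; 37; 34; 39; 50; 47;
    44; 57; 46; 33; 40; 43];
  Seed 19 [:: 22; 25; 28; 31; 18; 29; 12; 11; 8; 5; 24; 23; 30; 7; 6; 1; 2;
    9; 4; 15; 26; 21; 20; 17; 14; 27; 16; 3; 10; 13] [:: 52; 55; 58; 61; 48;
    59; 42] [:: 60; 41; 36; 53; 56; 51; 32; 35; 54; 37; 40; 39; 38; 45; 34;
    33; 50; 47; 44; 57; 46; 43];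
  Seed 26 [:: 23; 20; 17; 14; 27; 32; 29; 24; 19; 22; 25; 28; 31; 30; 13;
    16; 15; 4; 7; 12; 11; 6; 1; 18; 5; 8; 3; 2; 9; 10; 21] [:: 53; 50; 47;
    44; 33] [:: 38; 35; 36; 41; 60; 61; 48; 59; 42; 49; 54; 37; 34; 57; 40;
    43; 46; 45; 62; 39; 52; 55; 58; 51];
  Seed 15 [:: 32; 29; 24; 19; 22; 25; 28; 31; 18; 11; 8; 5; 12; 1; 2; 9; 4;
    7; 30; 23; 6; 13; 10; 21; 26; 3; 16; 33; 14; 17; 20; 27] [:: 38; 35; 36;
    41; 48; 61; 42; 49; 52; 55; 58; 51; 62; 59; 54; 43; 60; 53; 56] [:: 46;
    63; 50; 47; 44; 39; 40; 37; 34; 57];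
  Seed 32 [:: 29; 24; 19; 22; 25; 28; 31; 18; 23; 30; 13; 16; 21; 26; 33;
    34; 15; 8; 11; 12; 5; 2; 1; 6; 17; 20; 27; 14; 3; 4; 7; 10; 9] [:: 59;
    54; 37; 42; 61; 60; 49; 48; 41; 38; 35] [:: 58; 55; 36; 53; 56; 51; 52;
    45; 64; 57; 46; 43; 40; 63; 44; 47; 50; 39]].

(** The default seed satisfies [seed_ok] for no [n], so a missing entry would be detected. *)
Lemma seeds_ok :
  all (fun i => seed_ok (i + 5) (nth (Seed 0 [::] [::] [::]) seeds i))
      (iota 0 30).
Proof. by vm_compute. Qed.

Lemma exists_tour (n : nat) : 4 < n -> exists x s, tour n x s.
Proof.
(* The residue of [n - 5] selects the seed, the quotient counts the added blocks. *)
move=> n_gt4; have/allP/(_ ((n - 5) %% 30)) := seeds_ok.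
rewrite mem_iota ltn_mod => /(_ isT) /(seed_tour _ ((n - 5) %/ 30)) [s].
have -> : (n - 5) %% 30 + 5 + 30 * ((n - 5) %/ 30) = n by lia.
by move=> ?; eexists; exists s; eassumption.
Qed.

(** * Transfer to the graph on even labels *)

(** A proper multiple of 3 exceeds 5 and shares the factor 3 with 15. *)
Lemma good_admissible3 (m : nat) : good m -> admissible 3 m.
Proof.
case/andP=> odd_m good_m; rewrite /admissible odd_m odd_gt0 //=.
apply/negP => /(proper_multipleP _ (isT : prime 3)) [k k2 E].
case/orP: good_m; first by rewrite !inE; lia.
by rewrite E coprimeMl.
Qed.

Lemma good_admissible5 (m : nat) : good m -> admissible 5 m.
Proof.
case/andP=> odd_m good_m; rewrite /admissible odd_m odd_gt0 //=.
apply/negP => /(proper_multipleP _ (isT : prime 5)) [k k2 E].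
case/orP: good_m; first by rewrite !inE; lia.
by rewrite E coprimeMl.
Qed.

Lemma link_G35 (n : nat) (u v : vertex n) :
  link (val u)./2 (val v)./2 -> G35 n u v.
Proof.
have /mapP[x _ Ex] := ssvalP u; have /mapP[y _ Ey] := ssvalP v.
rewrite /link /= Ex Ey !mul2n !doubleK => /andP[sum_ok dif_ok].
(* Equal vertices would have difference 0, which is even. *)
have uv : u != v.
  apply: contraTneq dif_ok => Euv; move: Ey; rewrite -Euv Ex.
  by move/eqP; rewrite eqn_pmul2l // => /eqP->; rewrite /good subnn.
rewrite /= /G_rel uv /= Ex Ey.
have -> : (2 * x + 2 * y)./2 = x + y by lia.
have -> : `|2 * x - 2 * y|./2 = x - y + (y - x) by lia.
by rewrite !good_admissible3 ?good_admissible5.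
Qed.

Lemma lift_vertices (n : nat) (l : seq nat) : perm_eq l (iota 1 n) ->
  exists s : seq (vertex n),
    [/\ map (fun v => (val v)./2) s = l, uniq s & forall v, v \in s].
Proof.
move=> perm_l.
have mulK : cancel (muln 2) half by move=> i; rewrite mul2n doubleK.
have [s sE] : exists s : seq (vertex n), map val s = map (muln 2) l.
  (* Every doubled entry is a label, so [pmap insub] drops nothing. *)
  exists (pmap insub (map (muln 2) l)).
  rewrite (pmap_filter (insubK _)); apply/all_filterP/allP => i.
  rewrite (perm_mem (perm_map _ perm_l)) => iV.
  by rewrite insubT.
exists s; split.
- by rewrite (map_comp half val) sE -map_comp (eq_map mulK) map_id.
- rewrite -(map_inj_uniq val_inj) sE (map_inj_uniq (can_inj mulK)).
  by rewrite (perm_uniq perm_l) iota_uniq.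
- move=> v; rewrite -(mem_map val_inj) sE (perm_mem (perm_map _ perm_l)).
  exact: ssvalP.
Qed.

Lemma link_hamiltonian_path (n : nat) (l : seq nat) :
  sorted link l -> perm_eq l (iota 1 n) -> has_hamiltonian_path (G35 n).
Proof.
move=> sorted_l /lift_vertices[s [sE uniq_s full_s]].
exists s; split=> //; move: sorted_l; rewrite -sE sorted_map.
exact/sub_sorted/link_G35.
Qed.

Lemma link_hamiltonian (n : nat) (l : seq nat) :
  2 < n -> cycle link l -> perm_eq l (iota 1 n) -> hamiltonian (G35 n).
Proof.
move=> n_gt2 cycle_l perm_l.
have [s [sE uniq_s full_s]] := lift_vertices _ _ perm_l.
exists s; split=> //.
  apply/andP; split=> //; move: cycle_l; rewrite -sE cycle_map.
  exact/sub_cycle/link_G35.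
have := perm_size perm_l.
by rewrite -sE size_map size_iota => ->.
Qed.

Theorem theorem6p3 :
  (forall n : nat, has_hamiltonian_path (G35 n)) /\
  (forall n : nat, ~~ odd n -> 2 < n -> hamiltonian (G35 n)).
Proof.
split=> n => [|even_n n_gt2]; have [/exists_tour[x [s]]|n_le4] := ltnP 4 n.
- by case/and3P=> path_s perm_s _; apply: (link_hamiltonian_path _ (x :: s)).
(* The natural order works up to 4: consecutive sums are 3, 5, 7. *)
- apply: (link_hamiltonian_path _ (iota 1 n)) => //.
  by case: n n_le4 => [|[|[|[|[|]]]]].
- case/and3P=> path_s perm_s; rewrite even_n => /slink_link closing.
  by apply: (link_hamiltonian _ (x :: s)); rewrite //= rcons_path path_s.
(* Only [n] = 4 is left; the closing edge from 4 to 1 has sum 5 and difference 3. *)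
- apply: (link_hamiltonian _ (iota 1 n)) => //.
  by case: n n_le4 even_n n_gt2 => [|[|[|[|[|]]]]].
Qed.
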